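(* Let $\{F_n\}_{n\ge 0}$ be a sequence of natural numbers with $F_n\ge 1$ for $n\ge1$ (and $F_0=1$, or exceptionally $F_0=0$), and let $\Pi$ be the cobweb poset designated by it. Let $\chi\in I(\Pi)$ be the function with $\chi(x,y)=1$ if $y$ covers $x$ and $\chi(x,y)=0$ otherwise. Then for every integer $k\ge 1$ and all $x=\langle s,t\rangle$, $y=\langle u,v\rangle$ in $\Pi$, the $k$-th power of $\chi$ in $I(\Pi)$ satisfies $$\chi^k(x,y)=\sum_{x\lessdot z_1\lessdot\dots\lessdot z_{k-1}\lessdot y}1=\delta(t+k,v)\,F_{t+1}F_{t+2}\cdots F_{v-1},$$ where the sum is over tuples $(z_1,\dots,z_{k-1})$ of elements of $\Pi$ satisfying the indicated cover relations (for $k=1$ it is $1$ if $x\lessdot y$ and $0$ otherwise), and an empty product is $1$.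
   Context: Cobweb poset: for $s\ge 1$ the $s$-th level is $\Phi_s=\{\langle j,s\rangle : 1\le j\le F_s\}$, and $\Phi_0=\{\langle 1,0\rangle\}$ is a single root (this is also the convention when $F_0=0$). The cobweb poset is $\Pi=(V,\le)$ with $V=\bigcup_{s\ge 0}\Phi_s$ and $\langle s,t\rangle\le\langle u,v\rangle$ if and only if $t<v$, or $t=v$ and $s=u$. It is locally finite. We write $x\lessdot y$ if $y$ covers $x$, i.e. $x<y$ and the segment $[x,y]=\{z: x\le z\le y\}$ has exactly two elements. Incidence algebra: for an associative ring $R$ with identity, $I(\Pi)$ is the set of functions $f:\Pi\times\Pi\to R$ with $f(x,y)=0$ unless $x\le y$, with pointwise addition and scalar multiplication and product $(f*g)(x,y)=\sum_{x\le z\le y}f(x,z)g(z,y)$. Powers are with respect to $*$; $\delta(a,b)$ on integers is the Kronecker delta; integers are regarded as elements of $R$ in the usual way. *)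

(* Defs.v *)
From HB Require Import structures.
From mathcomp Require Import all_boot all_order all_algebra.
From mathcomp Require Import finmap.
From mathcomp Require Import mathcomp_extra boolp classical_sets functions.
From mathcomp Require Import cardinality fsbigop set_interval.

Set Implicit Arguments.
Unset Strict Implicit.
Unset Printing Implicit Defensive.

Import Order.TTheory GRing.Theory.

Local Open Scope classical_set_scope.
Local Open Scope card_scope.
Local Open Scope ring_scope.

HB.mixin Record isLocallyFinite d T of Order.POrder d T := {
  finite_segment : forall x y : T, finite_set `[x, y]%classic
}.

#[short(type="lfPOrderType")]
HB.structure Definition LocallyFinite d :=
  { T of isLocallyFinite d T & Order.POrder d T }.

Definition covers {d : Order.disp_t} {T : lfPOrderType d} : rel T :=
  fun x y => (x < y)%O && `[< `[x, y]%classic #= `I_2 >].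

Definition cover_chains {d : Order.disp_t} {T : lfPOrderType d}
    (x y : T) (n : nat) : set (n.-tuple T) :=
  [set z : n.-tuple T | path covers x (rcons z y)].
Arguments cover_chains {d T} x y n _.

(* Finiteness matters: a sum over an infinite support is 0 by convention. *)
Lemma finite_cover_chains {d : Order.disp_t} {T : lfPOrderType d}
    (x y : T) (n : nat) : finite_set (cover_chains x y n).
Proof.
have /finite_seqP[s sE] := finite_segment x y.
pose h (w : n.-tuple (seq_sub s)) : n.-tuple T := map_tuple val w.
apply: (@sub_finite_set _ _ (h @` setT)); last exact/finite_image/finite_finset.
move=> z zP.
have lez : path (fun a b : T => (a <= b)%O) x (rcons z y).
  by apply: sub_path zP => a b /andP[/ltW].
have zs a : a \in tval z -> a \in s.
  move=> az; suff: [set` s] a by [].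
  rewrite -sE set_itvE /=; apply/andP; split.
    have /allP := order_path_min le_trans lez.
    by apply; rewrite mem_rcons inE az orbT.
  move: lez; case/splitPr: az => p1 p2.
  rewrite rcons_cat rcons_cons cat_path /= => /and3P[_ _].
  move=> /(order_path_min le_trans) /allP; apply.
  by rewrite mem_rcons mem_head.
have szw : size (pmap insub (tval z) : seq (seq_sub s)) == n.
  rewrite size_pmap_sub -[X in _ == X](size_tuple z).
  rewrite -[X in _ == X](count_predT (tval z)).
  by apply/eqP/eq_in_count => a /zs ->.
exists (Tuple szw) => //.
apply: val_inj => /=; rewrite (pmap_filter (insubK _)).
by apply/all_filterP/allP => a /zs ai; rewrite isSome_insub.
Qed.

Section IncidenceAlgebra.
Context {d : Order.disp_t} (T : lfPOrderType d) (R : pzRingType).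

Definition incidence_pred : {pred T -> T -> R} :=
  fun f => `[< forall x y, ~~ (x <= y)%O -> f x y = 0 >].

Record incidence := Incidence {
  incidence_fun :> T -> T -> R;
  _ : incidence_fun \in incidence_pred
}.

HB.instance Definition _ := [isSub for incidence_fun].
HB.instance Definition _ := [Choice of incidence by <:].

Lemma incidence_zmod_closed : zmod_closed incidence_pred.
Proof.
split=> [|f g]; first by apply/asboolP.
move=> /asboolP f0 /asboolP g0; apply/asboolP => x y xy.
by rewrite !fctE f0// g0// subr0.
Qed.

HB.instance Definition _ :=
  GRing.isZmodClosed.Build (T -> T -> R) incidence_pred incidence_zmod_closed.
HB.instance Definition _ := [SubChoice_isSubZmodule of incidence by <:].

Implicit Types f g h : incidence.

Lemma incidence0 f x y : ~~ (x <= y)%O -> f x y = 0.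
Proof. by case: f => f /= /asboolP; apply. Qed.

Lemma incidenceP f g : (forall x y, f x y = g x y) -> f = g.
Proof. by move=> fg; apply: val_inj; apply/funext => x; apply/funext. Qed.

Definition conv_fun (f g : T -> T -> R) x y : R :=
  \sum_(z \in `[x, y]%classic) f x z * g z y.

Lemma conv_subproof f g : conv_fun f g \in incidence_pred.
Proof.
apply/asboolP => x y xy; apply: fsbig1 => z; rewrite set_itvE /= => /andP[xz zy].
by rewrite (le_trans xz zy) in xy.
Qed.

Definition conv f g := Incidence (conv_subproof f g).

Lemma unit_subproof : (fun x y : T => (x == y)%:R) \in incidence_pred.
Proof. by apply/asboolP => x y; case: eqVneq => [->|//]; rewrite lexx. Qed.

Definition incidence_one := Incidence unit_subproof.

Lemma convA : associative conv.
Proof.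
move=> f g h; apply/incidenceP => x y.
have fin a b := finite_segment (a : T) b.
transitivity (\sum_(z \in `[x, y]%classic) \sum_(w \in `[x, y]%classic)
    f x z * g z w * h w y).
  apply: eq_fsbigr => z; rewrite inE set_itvE /= => /andP[xz zy].
  rewrite /conv_fun fsbig_finite// mulr_sumr -fsbig_finite//.
  under eq_fsbigr do rewrite mulrA.
  apply: fsbig_widen => [w|w [_]]; rewrite !set_itvE /=.
    by move=> /andP[zw ->]; rewrite (le_trans xz zw).
  move/negP; rewrite negb_and => /orP[zw|wy].
    by rewrite (incidence0 g zw) mulr0 mul0r.
  by rewrite (incidence0 h wy) mulr0.
rewrite exchange_fsbig//; apply: eq_fsbigr => w; rewrite inE set_itvE /=.
move=> /andP[xw wy]; rewrite /conv_fun [in RHS]fsbig_finite// mulr_suml.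
rewrite -fsbig_finite//; symmetry.
apply: fsbig_widen => [z|z [_]]; rewrite !set_itvE /=.
  by move=> /andP[-> zw]; rewrite (le_trans zw wy).
move/negP; rewrite negb_and => /orP[xz|zw].
  by rewrite (incidence0 f xz) !mul0r.
by rewrite (incidence0 g zw) mulr0 mul0r.
Qed.

Lemma conv1 : left_id incidence_one conv.
Proof.
move=> f; apply/incidenceP => x y.
have [xy|xy] := boolP (x <= y)%O; last first.
  by rewrite !incidence0.
transitivity (\sum_(z \in [set x]) (x == z)%:R * f z y); last first.
  by rewrite fsbig_set1 eqxx mul1r.
symmetry; apply: fsbig_widen => [z ->|z [_ /= /eqP]].
  by rewrite set_itvE /= lexx.
by rewrite eq_sym => /negPf ->; rewrite mul0r.
Qed.

Lemma conv1r : right_id incidence_one conv.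
Proof.
move=> f; apply/incidenceP => x y.
have [xy|xy] := boolP (x <= y)%O; last first.
  by rewrite !incidence0.
transitivity (\sum_(z \in [set y]) f x z * (z == y)%:R); last first.
  by rewrite fsbig_set1 eqxx mulr1.
symmetry; apply: fsbig_widen => [z ->|z [_ /= /eqP]].
  by rewrite set_itvE /= lexx andbT.
by move=> /negPf ->; rewrite mulr0.
Qed.

Lemma incidenceD f g x y : (f + g) x y = f x y + g x y.
Proof. by []. Qed.

Lemma convE f g x y : conv f g x y = \sum_(z \in `[x, y]%classic) f x z * g z y.
Proof. by []. Qed.

Lemma convDl : left_distributive conv +%R.
Proof.
move=> f g h; apply/incidenceP => x y; rewrite incidenceD !convE.
rewrite !(fsbig_finite _ _ (finite_segment x y)) -big_split.
by apply: eq_bigr => z _; rewrite incidenceD mulrDl.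
Qed.

Lemma convDr : right_distributive conv +%R.
Proof.
move=> f g h; apply/incidenceP => x y; rewrite incidenceD !convE.
rewrite !(fsbig_finite _ _ (finite_segment x y)) -big_split.
by apply: eq_bigr => z _; rewrite incidenceD mulrDr.
Qed.

HB.instance Definition _ :=
  GRing.Zmodule_isPzRing.Build incidence convA conv1 conv1r convDl convDr.

Lemma cover_subproof : (fun x y : T => (covers x y)%:R) \in incidence_pred.
Proof.
apply/asboolP => x y xy; case: (boolP (covers x y)) => // /andP[/ltW].
by rewrite (negPf xy).
Qed.

Definition chi : incidence := Incidence cover_subproof.

End IncidenceAlgebra.

Definition level_size (F : nat -> nat) (s : nat) : nat :=
  if s is 0%N then 1%N else F s.

(* The vertex <j, s> is the pair (j, s): label first, level second. *)
Record cobweb (F : nat -> nat) := Cobweb {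
  cobweb_val :> nat * nat;
  _ : (1 <= cobweb_val.1 <= level_size F cobweb_val.2)%N
}.

Section CobwebPoset.
Variable F : nat -> nat.

HB.instance Definition _ := [isSub for @cobweb_val F].
HB.instance Definition _ := [Choice of cobweb F by <:].

Definition cobweb_le (x y : cobweb F) : bool :=
  (x.2 < y.2)%N || (x.2 == y.2) && (x.1 == y.1).

Lemma cobweb_le_refl : reflexive cobweb_le.
Proof. by move=> x; rewrite /cobweb_le !eqxx orbT. Qed.

Lemma cobweb_le_anti : antisymmetric cobweb_le.
Proof.
move=> x y /andP[/orP[xy|/andP[/eqP x2 /eqP x1] _]].
  by case/orP => [/(ltn_trans xy)|/andP[/eqP yx]]; [|move: xy; rewrite yx];
    rewrite ltnn.
by apply: val_inj; apply/eqP; rewrite -pair_eqE /pair_eq /= x1 x2 !eqxx.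
Qed.

Lemma cobweb_le_trans : transitive cobweb_le.
Proof.
rewrite /cobweb_le => y x z /orP[xy|/andP[/eqP-> /eqP->]//].
by case/orP => [/(ltn_trans xy)->//|/andP[/eqP<- _]]; rewrite xy.
Qed.

Fact cobweb_display : Order.disp_t. Proof. exact: Order.default_display. Qed.

HB.instance Definition _ := Order.Le_isPOrder.Build cobweb_display (cobweb F)
  cobweb_le_refl cobweb_le_anti cobweb_le_trans.

Lemma leEcobweb (x y : cobweb F) : (x <= y)%O = cobweb_le x y.
Proof. by []. Qed.

Lemma cobweb_finite_segment (x y : cobweb F) : finite_set `[x, y]%classic.
Proof.
pose s := [seq (j, l) | l <- iota 0 y.2.+1, j <- iota 0 (level_size F l).+1].
apply: (@sub_finite_set _ _ (@cobweb_val F @^-1` [set` s])).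
  move=> z; rewrite set_itvE /= => /andP[_ zy].
  have zy2 : (z.2 <= y.2)%N by case/orP: zy => [/ltnW|/andP[/eqP->]].
  case: z zy2 {zy} => -[j l] /= /andP[_ jl] ly.
  by apply/allpairsPdep; exists l, j; rewrite !mem_iota !add0n !ltnS.
by apply: finite_preimage => // a b _ _; exact: val_inj.
Qed.

HB.instance Definition _ :=
  isLocallyFinite.Build cobweb_display (cobweb F) cobweb_finite_segment.

End CobwebPoset.

(* Main.v *)
Require Import Defs.
From mathcomp Require Import all_boot all_order all_algebra.
From mathcomp Require Import finmap.
From mathcomp Require Import boolp classical_sets functions cardinality fsbigop.
From mathcomp Require Import set_interval.

Import Order.TTheory GRing.Theory.
Local Open Scope classical_set_scope.
Local Open Scope ring_scope.

(** In any locally finite poset, expanding a power of [chi] one factor at a time selects the tuples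
    in which consecutive elements cover each other, so the power counts cover chains ([chi_expE], by
    the recursion [fsum_cover_chainsS]). In the cobweb poset every level is nonempty, so a cover is
    exactly a step to the next level ([covers_cobweb]). A chain of [k] covers therefore climbs [k]
    levels, and each intermediate vertex is chosen freely on its level. Induction on [k] makes this
    precise ([chi_exp_cobweb]): the first intermediate vertex ranges over level [t + 1], every
    choice contributes equally, and [fsum_cobweb_level] yields the factor [F (t + 1)]. *)

Lemma coversP {d : Order.disp_t} {T : lfPOrderType d} (x y : T) :
  reflect ((x < y)%O /\ forall z, (x <= z <= y)%O -> z = x \/ z = y)
          (covers x y).
Proof.
have fin := finite_segment x y.
apply: (iffP andP) => -[xy].
  move=> /asboolP/card_fset_set card2; split=> // z xzy.
  have xy2 : [fset x; y]%fset = fset_set `[x, y]%classic.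
    apply/eqP; rewrite eqEfcard card2 cardfs2 (lt_eqF xy) andbT.
    apply/fsubsetP => w; rewrite in_fset_set// !inE set_itvE /=.
    by case/orP=> /eqP->; rewrite lexx (ltW xy).
  have : z \in [fset x; y]%fset by rewrite xy2 in_fset_set// inE set_itvE.
  by rewrite !inE => /orP[]/eqP->; [left|right].
move=> xzy; split=> //; apply/asboolP.
rewrite (_ : `[x, y]%classic = [set` [fset x; y]%fset]).
  by apply/card_eq_fsetP; rewrite cardfs2 (lt_eqF xy).
apply/seteqP; split=> z; rewrite set_itvE /= !inE.
  by case/xzy=> ->; rewrite eqxx ?orbT.
by case/orP=> /eqP->; rewrite lexx (ltW xy).
Qed.

(** Outside the segment one of the two factors vanishes. An index set independent of [x] and [y] can
    then be cut down to a single level. *)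
Lemma incidence_mulE {d : Order.disp_t} {T : lfPOrderType d} {R : pzRingType}
    (f g : incidence T R) (x y : T) :
  (f * g) x y = \sum_(z \in [set: T]) f x z * g z y.
Proof.
rewrite [LHS]convE; apply: fsbig_widen => // z [_].
rewrite set_itvE /= => /negP; rewrite negb_and => /orP[xz|zy].
  by rewrite (incidence0 f xz) mul0r.
by rewrite (incidence0 g zy) mulr0.
Qed.

Lemma fsum_cover_chains0 {d : Order.disp_t} {T : lfPOrderType d}
    {R : pzRingType} (x y : T) :
  \sum_(z \in cover_chains x y 0) (1 : R) = (covers x y)%:R.
Proof.
case: (boolP (covers x y)) => xy.
  rewrite (_ : cover_chains x y 0 = [set [tuple]]) ?fsbig_set1//.
  apply/seteqP; split=> z; first by move=> _; exact: tuple0.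
  by move=> ->; rewrite /cover_chains /= xy.
apply: fsbig1 => z; rewrite (tuple0 z) /cover_chains /= andbT.
by rewrite (negPf xy).
Qed.

(** A chain with [n.+1] intermediate elements is its first element [z] followed by a chain from [z]
    to [y]. *)
Lemma fsum_cover_chainsS {d : Order.disp_t} {T : lfPOrderType d}
    {R : pzRingType} (n : nat) (x y : T) :
  \sum_(z \in cover_chains x y n.+1) (1 : R) =
  \sum_(z \in `[x, y]%classic)
    (covers x z)%:R * \sum_(w \in cover_chains z y n) (1 : R).
Proof.
(* The set of tails depends on [z]. Gathering all tails in one finite set [Q], with the indicator
   [F] discarding the wrong ones, turns the nested sum into a sum over a product. *)
pose S := `[x, y]%classic; pose Q := \bigcup_(z in S) cover_chains z y n.
have finS : finite_set S := finite_segment x y.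
have finQ : finite_set Q.
  by apply: bigcup_finite => // z _; exact: finite_cover_chains.
pose F (z : T) (w : n.-tuple T) : R :=
  (covers x z && path covers z (rcons w y))%:R.
transitivity (\sum_(z \in S) \sum_(w \in Q) F z w); last first.
  apply: eq_fsbigr => z /set_mem Sz.
  have [xz|xz] := boolP (covers x z); last first.
    by rewrite mul0r fsbig1// => w _; rewrite /F (negPf xz).
  rewrite mul1r; symmetry; transitivity (\sum_(w \in cover_chains z y n) F z w).
    by apply: eq_fsbigr => w /set_mem; rewrite /F xz /cover_chains /= => ->.
  apply: fsbig_widen => [w zw|w [_]]; first by exists z.
  by rewrite /F xz /cover_chains /= => /negP/negPf ->.
rewrite pair_fsbig//.
pose h (p : T * n.-tuple T) : n.+1.-tuple T := cons_tuple p.1 p.2.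
pose G (z : n.+1.-tuple T) : R := (path covers x (rcons z y))%:R.
rewrite [RHS](_ : _ = \sum_(p \in S `*` Q) G (h p)); last first.
  by apply: eq_fsbigr.
(* Prepending the head to the tail is injective, so the sum over pairs becomes a sum over tuples. *)
rewrite -fsbig_image; last first.
  move=> [a v] [b w] _ _ /(congr1 val) [-> vw].
  by congr pair; apply: val_inj.
transitivity (\sum_(z \in cover_chains x y n.+1) G z).
  by apply: eq_fsbigr => z /set_mem; rewrite /G /cover_chains /= => ->.
(* The image of [h] contains every chain, and [G] vanishes on its other members. *)
apply: fsbig_widen => [z|z [_]]; last first.
  by rewrite /G /cover_chains /= => /negP/negPf ->.
case/tupleP: z => a w; rewrite /cover_chains /= => /andP[xa aw].
have Sa : S a.
  rewrite /S set_itvE /=; case/andP: (xa) => /ltW -> _ /=.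
  have lew : path (fun a b : T => (a <= b)%O) a (rcons w y).
    by apply: sub_path aw => b c /andP[/ltW].
  by have /allP := order_path_min le_trans lew; apply; rewrite mem_rcons mem_head.
exists (a, w); last exact: val_inj.
by split=> //; exists a.
Qed.

Lemma chi_expE {d : Order.disp_t} (T : lfPOrderType d) (R : pzRingType)
    (n : nat) (x y : T) :
  (chi T R ^+ n.+1) x y = \sum_(z \in cover_chains x y n) (1 : R).
Proof.
elim: n x => [|n IH] x; first by rewrite expr1 fsum_cover_chains0.
rewrite exprS fsum_cover_chainsS [LHS]convE.
by apply: eq_fsbigr => z _; rewrite IH.
Qed.

Section Cobweb.
Context {F : nat -> nat}.
Hypothesis Fpos : forall n : nat, (1 <= n)%N -> (1 <= F n)%N.
Implicit Types x y z : cobweb F.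

(* Every level being nonempty, two levels further apart than one are separated
   by an intermediate vertex. *)
Lemma covers_cobweb x y : covers x y = (y.2 == x.2.+1).
Proof.
apply/coversP/eqP => [[]|yx2].
  rewrite lt_def leEcobweb => /andP[yx /orP[xy2|]]; last first.
    case/andP=> /eqP xy2 /eqP xy1; case/eqP: yx; apply: val_inj => /=.
    by rewrite [LHS]surjective_pairing [RHS]surjective_pairing xy1 xy2.
  move=> cov; apply/eqP; rewrite eqn_leq xy2 andbT leqNgt; apply/negP => xy.
  have zP : (1 <= (1, x.2.+1).1 <= level_size F (1, x.2.+1).2)%N.
    by rewrite /= Fpos.
  have [] := cov (Cobweb zP); first by rewrite !leEcobweb /cobweb_le /= ltnSn xy.
    by move/(congr1 (fun z => (cobweb_val z).2)) => /= /eqP; rewrite gtn_eqF.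
  by move/(congr1 (fun z => (cobweb_val z).2)) => /= yE; rewrite yE ltnn in xy.
split=> [|z].
  rewrite lt_def leEcobweb /cobweb_le yx2 ltnSn andbT.
  by apply/eqP => yx; move: yx2; rewrite yx => /eqP; rewrite ltn_eqF.
rewrite !leEcobweb => /andP[/orP[xz|/andP[/eqP xz2 /eqP xz1]]]; last first.
  move=> _; left; apply: val_inj => /=.
  by rewrite [LHS]surjective_pairing [RHS]surjective_pairing xz1 xz2.
case/orP=> [|/andP[/eqP zy2 /eqP zy1]]; first by rewrite yx2 ltnS leqNgt xz.
right; apply: val_inj => /=.
by rewrite [LHS]surjective_pairing [RHS]surjective_pairing zy1 zy2.
Qed.

Lemma fsum_cobweb_level (V : nmodType) (s : nat) (c : V) :
  \sum_(z \in [set z : cobweb F | z.2 = s]) c = c *+ level_size F s.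
Proof.
(* Labels start at 1 and ordinals at 0, hence the shift in this enumeration of the level. *)
have hP (i : 'I_(level_size F s)) :
    (1 <= (i.+1, s).1 <= level_size F (i.+1, s).2)%N by rewrite /= ltn_ord.
pose h i : cobweb F := Cobweb (hP i).
rewrite (reindex_fsbig h setT); last first.
  split=> [i _ //|i j _ _ /(congr1 (fun z => (cobweb_val z).1)) [ij]|].
    exact: val_inj.
  move=> z /= zs; case: z zs => -[j l] /= zP lE; subst l.
  case: j zP => [//|j] zP; have js : (j < level_size F s)%N by case/andP: (zP).
  by exists (Ordinal js) => //; apply: val_inj.
pose r := index_enum 'I_(level_size F s).
rewrite (_ : setT = [set` r]); last first.
  by apply/seteqP; split=> // i _ /=; rewrite mem_index_enum.
by rewrite -fsbig_seq ?index_enum_uniq// sumr_const card_ord.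
Qed.

Lemma chi_exp_cobweb (R : pzRingType) (n : nat) x y :
  (chi (cobweb F) R ^+ n.+1) x y =
  (x.2 + n.+1 == y.2)%N%:R * \prod_(x.2.+1 <= i < y.2) (F i)%:R.
Proof.
elim: n x => [|n IH] x.
  rewrite expr1 /= covers_cobweb addn1 eq_sym.
  by case: eqP => [<-|_]; rewrite ?mul0r// big_geq// mulr1.
rewrite exprS incidence_mulE.
(* This is the inductive value at any [z] on the level just above [x]; it depends on [z] only
   through its level. *)
pose c : R := (x.2 + n.+2 == y.2)%N%:R * \prod_(x.2.+2 <= i < y.2) (F i)%:R.
transitivity (\sum_(z \in [set z : cobweb F | z.2 = x.2.+1]) c).
  symmetry; rewrite fsbig_mkcond; apply: eq_fsbigr => z _.
  rewrite IH /= covers_cobweb /patch; case: ifPn => [/set_mem/= ->|].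
    by rewrite eqxx mul1r /c addSnnS.
  rewrite notin_setE /= => zx.
  by case: eqP => [/zx//|_]; rewrite mul0r.
(* The level above [x] is never the root level, so its size reduces to [F x.2.+1]. *)
rewrite fsum_cobweb_level /c /=.
case: eqP => [xy|_]; last by rewrite !mul0r mul0rn.
(* The level size becomes the leading factor of the product, whose range is nonempty because [y]
   lies at least two levels above [x]. *)
rewrite !mul1r -mulr_natl [in RHS]big_ltn//.
by rewrite -xy !addnS ltnS ltnS leq_addr.
Qed.

End Cobweb.

Theorem mainTheorem5 (R : pzRingType) (F : nat -> nat)
    (F0 : F 0%N = 1%N \/ F 0%N = 0%N)
    (Fpos : forall n : nat, (1 <= n)%N -> (1 <= F n)%N)
    (k : nat) (k1 : (1 <= k)%N)
    (x y : cobweb F) (s t u v : nat)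
    (xE : cobweb_val x = (s, t)) (yE : cobweb_val y = (u, v)) :
  (chi (cobweb F) R ^+ k) x y = \sum_(z \in cover_chains x y k.-1) (1 : R) /\
  \sum_(z \in cover_chains x y k.-1) (1 : R) =
    (t + k == v)%N%:R * \prod_(t.+1 <= i < v) (F i)%:R.
Proof.
case: k k1 => // n _; rewrite -chi_expE; split=> //.
by rewrite chi_exp_cobweb// xE yE.
Qed.
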